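(* Let $a=\sum_{n\in\mathbb{Z},\,n\equiv 1 \pmod 3} x^{n^2}\in\mathbb{Z}/2[[x]]$, and let $B(a)$ be the set of integers $n$ such that the coefficient of $x^n$ in the Laurent series $1/a$ equals $1$. Let $U^*$ be the set of integers $n\ge 0$ with $n\equiv 0\pmod 2$, or $n\equiv 1\pmod 4$, or $n\equiv 3\pmod 8$. Then: (1) every element $n$ of $B(a)$ that lies in $U^*$ is the product of a prime and a square; (2) the number of elements of $B(a)$ that are $\le X$ and lie in $U^*$ is $O(X/\log X)$.
   Context: All power series have coefficients in $\mathbb{Z}/2$; $1/a$ is taken in the field of Laurent series over $\mathbb{Z}/2$, the fraction field of $\mathbb{Z}/2[[x]]$. (In the paper's general notation, with $l=3$, $a=[1]=[2]$ and $U^*$ is the complement in $\mathbb{Z}_{\ge0}$ of the basic class $n\equiv -1\pmod 8$.) *)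

(* Defs.v *)
From HB Require Import structures.
From mathcomp Require Import all_boot all_order all_algebra.
From mathcomp Require Import finmap.
From mathcomp Require Import all_classical all_reals all_analysis.
From mathcomp Require Import zify.

Set Implicit Arguments.
Unset Strict Implicit.
Unset Printing Implicit Defensive.

Import Order.TTheory GRing.Theory Num.Theory.
Import numFieldNormedType.Exports.

Local Open Scope classical_set_scope.
Local Open Scope ring_scope.

(* The field F((x)) of formal Laurent series over a field F. A series is      *)
(* identified with its coefficient function int -> F, which must vanish       *)
(* below some integer; [f n] is the coefficient of x^n in f.                  *)

Definition bounded_below_pred (F : fieldType) : {pred int -> F} :=
  fun f => `[< exists N : int, forall n, n < N -> f n = 0 >].

Record laurent (F : fieldType) := Laurent {
  lcoef :> int -> F;
  lcoefP : lcoef \in @bounded_below_pred F }.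

HB.instance Definition _ (F : fieldType) := [isSub for @lcoef F].
HB.instance Definition _ (F : fieldType) := [Choice of laurent F by <:].

Fact bounded_below_zmod_closed (F : fieldType) :
  zmod_closed (@bounded_below_pred F).
Proof.
split=> [|f g /asboolP[N fN] /asboolP[M gM]]; apply/asboolP; first by exists 0.
exists (Num.min N M) => n; rewrite lt_min => /andP[nN nM].
by rewrite /GRing.add /= /GRing.opp /= fN// gM// subr0.
Qed.

HB.instance Definition _ (F : fieldType) :=
  GRing.isZmodClosed.Build (int -> F) (@bounded_below_pred F)
    (bounded_below_zmod_closed F).
HB.instance Definition _ (F : fieldType) :=
  [SubChoice_isSubZmodule of laurent F by <:].

Lemma lcoef_bound (F : fieldType) (f : laurent F) :
  exists N : int, forall n, n < N -> f n = 0.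
Proof. by apply/asboolP; exact: lcoefP. Qed.

Lemma laurentP (F : fieldType) (f g : laurent F) : f =1 g -> f = g.
Proof. by move=> fg; apply/val_inj/funext. Qed.

(* The Cauchy product; the sum has finite support.                            *)
Definition conv (F : fieldType) (f g : int -> F) (n : int) : F :=
  \sum_(i \in [set: int]) f i * g (n - i).

Lemma convE (F : fieldType) (f g : int -> F) (N M : int) (k : nat) :
  (forall n, n < N -> f n = 0) -> (forall n, n < M -> g n = 0) ->
  conv f g (N + M + k%:Z) =
  \sum_(i < k.+1) f (N + i%:Z) * g (M + (k - i)%N%:Z).
Proof.
move=> fN gM; rewrite /conv.
rewrite -(@fsbig_widen _ _ _ _ ((fun j : nat => N + j%:Z) @` `I_k.+1))//; last first.
  move=> i [_ /= iI]; have [iN|iN] := ltP i N; first by rewrite fN ?mul0r.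
  rewrite gM ?mulr0//; rewrite ltNge; apply/negP => kM; apply: iI.
  by exists `|i - N|%N; lia.
rewrite fsbig_image; last by move=> i j _ _ /addrI[].
rewrite -fsbig_ord; apply: eq_bigr => i _; congr (_ * g _).
by have := ltn_ord i; lia.
Qed.

Lemma conv_lt (F : fieldType) (f g : int -> F) (N M n : int) :
  (forall n, n < N -> f n = 0) -> (forall n, n < M -> g n = 0) ->
  n < N + M -> conv f g n = 0.
Proof.
move=> fN gM nNM; rewrite /conv fsbig1// => i _.
have [iN|iN] := ltP i N; first by rewrite fN ?mul0r.
by rewrite gM ?mulr0//; lia.
Qed.

Fact conv_bounded (F : fieldType) (f g : laurent F) :
  conv f g \in @bounded_below_pred F.
Proof.
have [N fN] := lcoef_bound f; have [M gM] := lcoef_bound g.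
by apply/asboolP; exists (N + M) => n; exact: conv_lt.
Qed.

Definition lmul (F : fieldType) (f g : laurent F) : laurent F :=
  Laurent (conv_bounded f g).

Fact lmono_bounded (F : fieldType) (k : int) :
  (fun n : int => (n == k)%:R : F) \in @bounded_below_pred F.
Proof. by apply/asboolP; exists k => n; rewrite lt_neqAle => /andP[/negPf->]. Qed.

Definition lmono (F : fieldType) (k : int) : laurent F :=
  Laurent (lmono_bounded F k).

Lemma int_ge_ex (N n : int) : N <= n -> exists k : nat, n = N + k%:Z.
Proof. by move=> Nn; exists `|n - N|%N; lia. Qed.

(* Coefficients of a product are those of a product of truncations. *)
Definition ltrunc (F : fieldType) (f : int -> F) (N : int) (K : nat) : {poly F} :=
  \poly_(k < K) f (N + k%:Z).

Lemma conv_trunc (F : fieldType) (f g : int -> F) (N M : int) (k K : nat) :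
  (forall n, n < N -> f n = 0) -> (forall n, n < M -> g n = 0) -> (k < K)%N ->
  conv f g (N + M + k%:Z) = (ltrunc f N K * ltrunc g M K)`_k.
Proof.
move=> fN gM kK; rewrite convE// coefM; apply: eq_bigr => i _.
have ik := ltn_ord i; rewrite !coef_poly.
by rewrite (leq_trans ik kK) (leq_ltn_trans (leq_subr _ _) kK).
Qed.

Fact lmulC (F : fieldType) : commutative (@lmul F).
Proof.
move=> f g; apply: laurentP => n /=.
have [N fN] := lcoef_bound f; have [M gM] := lcoef_bound g.
have [nNM|/int_ge_ex[k ->]] := ltP n (N + M).
  by rewrite (conv_lt fN gM)// (conv_lt gM fN)// addrC.
by rewrite (conv_trunc fN gM (ltnSn k)) mulrC -(conv_trunc gM fN)// [M + N]addrC.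
Qed.

Fact lmulA (F : fieldType) : associative (@lmul F).
Proof.
move=> f g h; apply: laurentP => n.
have [N fN] := lcoef_bound f; have [M gM] := lcoef_bound g.
have [L hL] := lcoef_bound h.
have fgNM i : i < N + M -> lmul f g i = 0 by exact: conv_lt.
have ghML i : i < M + L -> lmul g h i = 0 by exact: conv_lt.
have [nNML|/int_ge_ex[k ->]] := ltP n (N + (M + L)).
  by rewrite [LHS](conv_lt fN ghML)// [RHS](conv_lt fgNM hL)// -addrA.
rewrite [LHS](conv_trunc fN ghML (ltnSn k)).
rewrite [in RHS]addrA [RHS](conv_trunc fgNM hL (ltnSn k)).
transitivity ((ltrunc f N k.+1 * (ltrunc g M k.+1 * ltrunc h L k.+1))`_k).
  rewrite [LHS]coefM [RHS]coefM; apply: eq_bigr => i _; congr (_ * _).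
  rewrite [LHS]coef_poly ltnS leq_subr.
  by apply: (conv_trunc gM hL); rewrite ltnS leq_subr.
rewrite mulrA [LHS]coefM [RHS]coefM; apply: eq_bigr => i _; congr (_ * _).
by rewrite [RHS]coef_poly ltn_ord; apply/esym/(conv_trunc fN gM)/ltn_ord.
Qed.

Fact lmul1l (F : fieldType) : left_id (lmono F 0) (@lmul F).
Proof.
move=> f; apply: laurentP => n /=; rewrite /conv.
rewrite -(@fsbig_widen _ _ _ _ [set 0])//=; last first.
  by move=> i [_ /= /eqP/negPf ->]; rewrite mul0r.
by rewrite fsbig_set1 eqxx mul1r subr0.
Qed.

Fact lmulDl (F : fieldType) : left_distributive (@lmul F) +%R.
Proof.
move=> f g h; apply: laurentP => n.
have [N fN] := lcoef_bound f; have [M gM] := lcoef_bound g.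
have [L hL] := lcoef_bound h.
pose P := Num.min N M.
have fP i : i < P -> f i = 0 by rewrite lt_min => /andP[/fN].
have gP i : i < P -> g i = 0 by rewrite lt_min => /andP[_ /gM].
have fgP i : i < P -> (f + g) i = 0.
  by move=> iP; rewrite [LHS](_ : _ = f i + g i)// fP// gP// addr0.
have [nPL|/int_ge_ex[k ->]] := ltP n (P + L).
  rewrite [LHS](conv_lt fgP hL)//.
  rewrite [RHS](_ : _ = lmul f h n + lmul g h n)//.
  by rewrite [lmul f h n](conv_lt fP hL)// [lmul g h n](conv_lt gP hL)// addr0.
rewrite [LHS](convE _ fgP hL).
rewrite [RHS](_ : _ = lmul f h (P + L + k%:Z) + lmul g h (P + L + k%:Z))//.
rewrite [lmul f h _](convE _ fP hL) [lmul g h _](convE _ gP hL) -big_split.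
by apply: eq_bigr => i _; exact: mulrDl.
Qed.

Fact lone_neq0 (F : fieldType) : lmono F 0 != 0.
Proof.
apply/eqP => /(congr1 (fun f : laurent F => f 0)).
by apply/eqP; exact: oner_neq0.
Qed.

HB.instance Definition _ (F : fieldType) :=
  GRing.Zmodule_isComNzRing.Build (laurent F) (@lmulA F) (@lmulC F)
    (@lmul1l F) (@lmulDl F) (lone_neq0 F).

Lemma powser_inv_exists (F : fieldType) (u : nat -> F) : u 0%N != 0 ->
  exists v : nat -> F, forall k,
    \sum_(i < k.+1) v i * u (k - i)%N = (k == 0%N)%:R.
Proof.
move=> u0.
pose fix vs n := if n is m.+1 then
  rcons (vs m) (- (\sum_(i < n) (vs m)`_i * u (n - i)%N) / u 0%N)
  else [:: (u 0%N)^-1].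
have svs n : size (vs n) = n.+1 by elim: n => //= n IH; rewrite size_rcons IH.
have vsE n i : (i <= n)%N -> (vs n)`_i = (vs i)`_i.
  elim: n => [|n IH]; first by rewrite leqn0 => /eqP->.
  rewrite leq_eqVlt => /predU1P[->//|]; rewrite ltnS => iLn.
  by rewrite [LHS]nth_rcons svs ltnS iLn IH.
exists (fun n => (vs n)`_n) => -[|k].
  by rewrite big_ord_recl big_ord0 addr0 subn0 /= mulVf.
rewrite big_ord_recr /= subnn nth_rcons svs ltnn eqxx mulfVK//.
apply/eqP; rewrite subr_eq0; apply/eqP/eq_bigr => i _.
by rewrite (vsE k i)// -ltnS.
Qed.

Lemma laurent_inv_exists (F : fieldType) (f : laurent F) : f != 0 ->
  exists g : laurent F, g * f = 1.
Proof.
move=> f0; have [N0 fN0] := lcoef_bound f.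
have ex : exists k : nat, f (N0 + k%:Z) != 0.
  apply: contrapT => H; move/eqP: f0; apply; apply: laurentP => n.
  have [/fN0//|/int_ge_ex[k ->]] := ltP n N0.
  by apply/eqP/negPn/negP => fk; apply: H; exists k.
case: (ex_minnP ex) => k0 fk0 kmin; set N := N0 + k0%:Z in fk0.
have fN n : n < N -> f n = 0.
  have [/fN0//|/int_ge_ex[k ->] kN] := ltP n N0.
  by apply/eqP/negPn/negP => /kmin; rewrite /N in kN; lia.
have [|v vE] := @powser_inv_exists F (fun k => f (N + k%:Z)).
  by rewrite addr0.
pose g (n : int) := if n < - N then 0 else v (absz (n + N)).
have gN n : n < - N -> g n = 0 by rewrite /g => ->.
have gB : g \in @bounded_below_pred F by apply/asboolP; exists (- N).
exists (Laurent gB); apply: laurentP => n.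
have [nlt|/int_ge_ex[k ->]] := ltP n (- N + N).
  rewrite [LHS](conv_lt gN fN)//.
  by rewrite [RHS](_ : _ = (n == 0)%:R)//; move: nlt; case: eqP => // ->; lia.
rewrite [LHS](convE _ gN fN).
rewrite [RHS](_ : _ = (- N + N + k%:Z == 0)%:R)// addNr add0r.
rewrite (_ : (k%:Z == 0) = (k == 0%N))// -vE; apply: eq_bigr => i _.
congr (_ * _); rewrite /g ifF; last by lia.
by congr (v _); lia.
Qed.

Definition linv (F : fieldType) (f : laurent F) : laurent F :=
  xget 0 [set g : laurent F | g * f = 1].

Fact lmulVf (F : fieldType) (f : laurent F) : f != 0 -> linv f * f = 1.
Proof.
by rewrite /linv; case: xgetP => // nx /laurent_inv_exists[g /nx].
Qed.

Fact linv0 (F : fieldType) : linv (0 : laurent F) = 0.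
Proof.
rewrite /linv; case: xgetP => // g _; rewrite /= mulr0 => /esym/eqP.
by rewrite oner_eq0.
Qed.

HB.instance Definition _ (F : fieldType) :=
  GRing.ComNzRing_isField.Build (laurent F) (@lmulVf F) (@linv0 F).

(* The series a = sum of x^(n^2) over the integers n = 1 mod 3, with sum      *)
(* taken coefficientwise: for each m, only finitely many n contribute.        *)
Definition a_coef (m : int) : 'F_2 :=
  \sum_(n \in [set n : int | (n = 1 %[mod 3])%Z]) lmono 'F_2 (n ^+ 2) m.

Lemma a_summable (m : int) :
  finite_set [set n : int | lmono 'F_2 (n ^+ 2) m != 0].
Proof.
apply: (@sub_finite_set _ _
  ((fun j : nat => j%:Z - `|m|%N%:Z) @` `I_(`|m|.*2.+1))); last first.
  exact/finite_image/finite_II.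
move=> n /=; have [->|] := eqVneq m (n ^+ 2); last by rewrite eqxx.
by move=> _; exists (absz (n + (absz (n ^+ 2))%:Z)); rewrite ?expr2/=; nia.
Qed.

Fact a_bounded : a_coef \in @bounded_below_pred 'F_2.
Proof.
apply/asboolP; exists 0 => m m0; rewrite /a_coef fsbig1// => n _ /=.
by case: eqP => // mn; move: m0; rewrite mn ltNge sqr_ge0.
Qed.

Definition a : laurent 'F_2 := Laurent a_bounded.

Definition B (f : laurent 'F_2) : set int := [set n | (f^-1) n = 1].

Definition Ustar : set int :=
  [set n | 0 <= n /\
     [\/ (n = 0 %[mod 2])%Z, (n = 1 %[mod 4])%Z | (n = 3 %[mod 8])%Z]].

Definition prime_times_square (n : int) : Prop :=
  exists (p : nat) (k : int), prime p /\ n = p%:Z * k ^+ 2.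

Definition BU_upto (R : realType) (X : R) : set int :=
  [set n | [/\ B a n, Ustar n & n%:~R <= X]].

Lemma BU_upto_finite (R : realType) (X : R) : finite_set (BU_upto X).
Proof.
apply: (@sub_finite_set _ _ ((fun j : nat => j%:Z) @` `I_(Num.truncn X).+1)).
  move=> n [_ [n0 _] nX]; exists `|n|%N; last by lia.
  rewrite /= ltnS truncn_ge_nat; last by apply: le_trans nX; rewrite ler0z.
  by rewrite natr_absz ger0_norm.
exact/finite_image/finite_II.
Qed.

(* [fset_set] is the set itself, by [BU_upto_finite]; on infinite sets it     *)
(* would be empty.                                                            *)
Definition BU_count (R : realType) (X : R) : nat := #|` fset_set (BU_upto X)|.

(* Lets the Landau notations be used with the filter +oo.                     *)
Canonical pinfty_filter_on (R : numFieldType) : filter_on R :=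
  FilterType (pinfty_nbhs R) (@filter_filter R _ proper_pinfty_nbhs).

(* Main.v *)
Require Import Defs.
From mathcomp Require Import all_boot all_order all_algebra finmap.
From mathcomp Require Import all_classical all_reals all_analysis.
From mathcomp Require Import zify ring lra.
Set Implicit Arguments.
Unset Strict Implicit.
Unset Printing Implicit Defensive.
Import Order.TTheory GRing.Theory Num.Theory.
Import numFieldNormedType.Exports.

(* Squaring is f(x) |-> f(x^2) over F_2, so the even part of a is a^4.        *)
(* Writing o = a + a^4 for the odd part, with exponents 1 mod 8, and b = 1/a, *)
(* b = a b^2 = a^2 + o b^2; iterating,                                        *)
(*   b = a^2 + o a^4 + o^3 a^8 + o^7 b^8,                                     *)
(* where the exponents of the terms are 0 mod 2, 1 mod 4, 3 mod 8, 7 mod 8.   *)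
(* So for n in U^* the coefficient of x^n in b is the parity of the number of *)
(* representations of n, by numbers prime to 3, as 2 m^2, m^2 + 4 k^2 (m odd) *)
(* or m^2 + 2 k^2 + 8 j^2 (m, k odd). The last form is reduced to m^2 + 2 k^2 *)
(* by an involution exchanging two of three squares. The involutions of       *)
(* Zagier and Jackson, applied to composite n, show that the number of        *)
(* representations by the binary forms is congruent mod 2                     *)
(* to half the number of divisors of n, which is odd only if n is             *)
(* a prime times a square. For the count, a pair (p, k) with p k^2 <= X has   *)
(* either p < X^(1/4), giving O(X^(3/4)) pairs, or p >= X^(1/4); the product  *)
(* of p over the latter pairs is at most prod_k 4^(X/k^2) <= 4^(2X).          *)

(** The iterated recursion is [a_inv_expansion]. By [supp_terms] its four terms have exponents in
    disjoint residue classes, and the class 7 mod 8 of the last is the one that [Ustar] omits;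
    [gf_coef] turns the remaining coefficients into parities of representation numbers. A
    representation by the second or third form makes n = 2 mod 3. Such an n is not a square, and the
    congruence conditions on the summands of the binary forms become automatic. [ternary_parity]
    reduces the third form to a binary one; [two_squares_parity] and
    [square_plus_twice_square_parity] then leave the parity of the number of divisors below the
    square root of n. If it is odd, 4 does not divide the number of divisors, and
    [prime_times_square_of_divisors] applies. The count uses only the shape p k^2
    ([count_prime_square]), with [primorial_le] controlling the large primes. *)

Lemma odd_size_involution (T : eqType) (s : seq T) (f : T -> T) :
  uniq s -> {in s, forall x, f x \in s} -> {in s, forall x, f (f x) = x} ->
  odd (size s) = odd (count (fun x => f x == x) s).
Proof.
have [m] := ubnP (size s); elim: m s => // m IH [//|x s] /= sm /andP[xs us] fs fK.
have [fx|fx] := eqVneq (f x) x.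
  rewrite oddD /= (IH s)// => y ys.
    have := fs y; rewrite !inE ys orbT => /(_ isT)/predU1P[fyx|//].
    by move: (fK y); rewrite inE ys orbT fyx fx => /(_ isT) yx; rewrite yx ys in xs.
  by apply: fK; rewrite inE ys orbT.
have fxs : f x \in s.
  by have := fs x; rewrite !inE eqxx (negPf fx) => /(_ isT).
have ffx : f (f x) = x by apply: fK; rewrite inE eqxx.
have /permP pc := perm_to_rem fxs.
rewrite add0n pc /= ffx eq_sym (negPf fx) add0n -IH ?rem_uniq//.
- by rewrite size_rem//; case: (s) fxs => //= ? ? _; rewrite negbK.
- by rewrite size_rem//; lia.
- move=> y; rewrite !mem_rem_uniq// !inE => /andP[yfx ys].
  have yx : y != x by apply: contraNneq xs => <-.
  have := fs y; rewrite !inE ys orbT => /(_ isT).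
  have fKy : f (f y) = y by apply: fK; rewrite inE ys orbT.
  case/predU1P => [fyx|->]; first by rewrite -fyx fKy eqxx in yfx.
  by rewrite andbT; apply: contra_neq yx => /(congr1 f); rewrite fKy ffx.
- by move=> y /mem_rem ys; apply: fK; rewrite inE ys orbT.
Qed.

Lemma size_bij (T U : eqType) (s : seq T) (t : seq U) (f : T -> U) (g : U -> T) :
  uniq s -> uniq t ->
  {in s, forall x, f x \in t /\ g (f x) = x} ->
  {in t, forall y, g y \in s /\ f (g y) = y} -> size s = size t.
Proof.
move=> us ut fs gt; apply/eqP; rewrite eqn_leq; apply/andP; split.
  rewrite -(size_map f) uniq_leq_size//.
    by rewrite map_inj_in_uniq// => x y /fs[_ {2}<-] /fs[_ {2}<-] ->.
  by move=> _ /mapP[x /fs[fx _] ->].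
rewrite -(size_map g) uniq_leq_size//.
  by rewrite map_inj_in_uniq// => x y /gt[_ {2}<-] /gt[_ {2}<-] ->.
by move=> _ /mapP[x /gt[fx _] ->].
Qed.

Definition box2 N := [seq (x, y) | x <- iota 0 N.+1, y <- iota 0 N.+1].

Definition box3 N := [seq (t, z) | t <- box2 N, z <- iota 0 N.+1].

Lemma uniq_box2 N : uniq (box2 N).
Proof. by apply: allpairs_uniq; rewrite ?iota_uniq// => -[? ?] [? ?]. Qed.

Lemma uniq_box3 N : uniq (box3 N).
Proof. by apply: allpairs_uniq; rewrite ?iota_uniq ?uniq_box2// => -[? ?] [? ?]. Qed.

Lemma mem_box2 N x y : ((x, y) \in box2 N) = (x <= N) && (y <= N).
Proof.
apply/allpairsP/andP => [[[u v] [+ + [-> ->]]]|[xN yN]].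
  by rewrite !mem_iota !add0n.
by exists (x, y); rewrite !mem_iota.
Qed.

Lemma mem_box3 N x y z : ((x, y, z) \in box3 N) = [&& x <= N, y <= N & z <= N].
Proof.
apply/allpairsP/and3P => [[[[a b] c] [+ + [-> -> ->]]]|[xN yN zN]].
  by rewrite mem_box2 mem_iota => /andP[].
by exists (x, y, z); rewrite mem_box2 mem_iota xN yN; split.
Qed.

(** * Windmill involutions: Zagier (c = 4) and Jackson (c = 2) *)

Definition windmill_eq (c n : nat) (t : nat * nat * nat) :=
  let: (x, y, z) := t in x * x + c * (y * z) == n.

Definition zagier (t : nat * nat * nat) := let: (x, y, z) := t in
  if x + z < y then (x + z.*2, z, y - x - z)
  else if x < y.*2 then (y.*2 - x, y, x + z - y)
  else (x - y.*2, x + z - y, y).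

Definition jackson (t : nat * nat * nat) := let: (x, y, z) := t in
  if y.*2 < x then (x - y.*2, z + x.*2 - y.*2, y)
  else if y.*2 < x.*2 + z then (y.*2 - x, y, x.*2 + z - y.*2)
  else if y.*2 < 3 * x + z.*2 then
    (3 * x + z.*2 - y.*2, x.*2 + z.*2 - y, y.*2 - x.*2 - z)
  else if y < x.*2 + z.*2 then
    (y.*2 - 3 * x - z.*2, y.*2 - x.*2 - z, x.*2 + z.*2 - y)
  else (x + z.*2, z, y - x.*2 - z.*2).

(* Equality in a test of [zagier] would make n even or a square. *)
Lemma zagierP n x y z : n %% 4 = 1 -> (forall m, m * m <> n) ->
  windmill_eq 4 n (x, y, z) ->
  [/\ 0 < x, 0 < y, 0 < z, x + z != y & x != y.*2].
Proof.
move=> n4 nsq /eqP e; have := nsq x; have := nsq (y + z) => h1 h2.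
split; rewrite ?lt0n; apply/eqP => h; subst; lia.
Qed.

(** The first and third branches of [zagier] are exchanged; the second is mapped to itself. *)
Lemma zagierK n t : n %% 4 = 1 -> (forall m, m * m <> n) ->
  windmill_eq 4 n t -> windmill_eq 4 n (zagier t) /\ zagier (zagier t) = t.
Proof.
move: t => [[x y] z] n4 nsq St; have [x0 y0 z0 b1 b2] := zagierP n4 nsq St.
move: St => /eqP e; rewrite /zagier.
case: ifPn => c1; last case: ifPn => c2.
- split; first by apply/eqP; nia.
  rewrite !ifF; [|lia|lia]. congr (_, _, _); lia.
- split; first by apply/eqP; nia.
  rewrite ifF ?ifT; [|lia|lia]. congr (_, _, _); lia.
- split; first by apply/eqP; nia.
  rewrite ifT; [|lia]. congr (_, _, _); lia.
Qed.

Lemma sqr_mod3 i : i * i %% 3 = (i %% 3 != 0).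
Proof.
rewrite -modnMm; have : i %% 3 < 3 by rewrite ltn_mod.
by case: (i %% 3) => [|[|[|]]].
Qed.

Lemma sqr_mod4 i : i * i %% 4 <= 1.
Proof.
rewrite -modnMm; have : i %% 4 < 4 by rewrite ltn_mod.
by case: (i %% 4) => [|[|[|[|]]]].
Qed.

Lemma sqr_mod8 i : i * i %% 8 \in [:: 0; 1; 4].
Proof.
rewrite -modnMm; have : i %% 8 < 8 by rewrite ltn_mod.
by case: (i %% 8) => [|[|[|[|[|[|[|[|]]]]]]]].
Qed.

Lemma nonsquare_mod8 n m : n %% 8 = 3 -> m * m <> n.
Proof. by move=> n8 e; have := sqr_mod8 m; rewrite e n8. Qed.

(* Equality in a test of [jackson] would make n even or a square. *)
Lemma jacksonP n x y z : n %% 8 = 3 -> windmill_eq 2 n (x, y, z) ->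
  [/\ 0 < x, 0 < y, 0 < z &
    [/\ y.*2 != x, y.*2 != x.*2 + z, y.*2 != 3 * x + z.*2 & y != x.*2 + z.*2]].
Proof.
move=> n8 /eqP e; have nsq m := @nonsquare_mod8 n m n8.
have := nsq x; have := nsq (x + z); have := nsq (x + z.*2) => h0 h1 h2.
have xo : odd x by apply/negPn/negP => /even_halfK xe; rewrite -xe in e; lia.
split; rewrite ?lt0n; try (apply/eqP => h; subst; lia).
split; apply/eqP => h; [lia| |lia|subst;lia].
by apply: h1; nia.
Qed.

(** The first and fifth branches of [jackson] are exchanged; each of the three middle ones is mapped
    to itself. *)
Lemma jacksonK n t : n %% 8 = 3 ->
  windmill_eq 2 n t -> windmill_eq 2 n (jackson t) /\ jackson (jackson t) = t.
Proof.
move: t => [[x y] z] n8 St; have [x0 y0 z0 [b1 b2 b3 b4]] := jacksonP n8 St.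
move: St => /eqP e; rewrite /jackson.
case: ifPn => c1; last case: ifPn => c2; last case: ifPn => c3; last case: ifPn => c4.
- split; first by apply/eqP; nia.
  rewrite !ifF; try lia. congr (_, _, _); lia.
- split; first by apply/eqP; nia.
  rewrite ifF 1?ifT; try lia. congr (_, _, _); lia.
- split; first by apply/eqP; nia.
  rewrite ifF; [rewrite ifF; [rewrite ifT|]|]; try lia. congr (_, _, _); lia.
- split; first by apply/eqP; nia.
  rewrite ifF; [rewrite ifF; [rewrite ifF; [rewrite ifT|]|]|]; try lia. congr (_, _, _); lia.
- split; first by apply/eqP; nia.
  rewrite ifT; try lia. congr (_, _, _); lia.
Qed.

(* The involutions (x, y, z) |-> (x, z, y) and F of the same finite set have
   fixed points of equal parity: representations x^2 + c y^2 of n for the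
   former, factorizations n = x (x + c z) for the latter. *)
Lemma windmill_parity (c n : nat) (F : nat * nat * nat -> nat * nat * nat) :
  let S := windmill_eq c n in
  0 < c ->
  (forall x y z, S (x, y, z) -> [/\ 0 < x, 0 < y & 0 < z]) ->
  (forall t, S t -> S (F t) /\ F (F t) = t) ->
  (forall x y z, S (x, y, z) -> (F (x, y, z) == (x, y, z)) = (x == y)) ->
  (forall d e, d * e = n -> d < e -> c %| e - d) ->
  odd (count (fun t => t.1 * t.1 + c * (t.2 * t.2) == n) (box2 n)) =
  odd (count (fun d => (d %| n) && (d * d < n)) (iota 1 n)).
Proof.
move=> S c0 S0 FS Ffix cdvd.
(* Positivity of the coordinates bounds each of them by n, so the solutions form a finite set. *)
have Sbox t : S t -> t \in box3 n.
  case: t => [[x y] z] St; have [x0 y0 z0] := S0 _ _ _ St; move/eqP: St => St.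
  have cyz : y * z <= c * (y * z) by rewrite leq_pmull.
  by rewrite mem_box3; apply/and3P; split; nia.
pose s := [seq t <- box3 n | S t].
have us : uniq s by rewrite filter_uniq ?uniq_box3.
have sE t : (t \in s) = S t.
  by rewrite mem_filter; case: (boolP (S t)) => // /Sbox.
clearbody s.
pose sw (t : nat * nat * nat) := (t.1.1, t.2, t.1.2).
have swS t : S t -> S (sw t) by case: t => [[x y] z] /=; rewrite [z * y]mulnC.
have := @odd_size_involution _ s sw us; rewrite (@odd_size_involution _ s F us); first last.
- by move=> t; rewrite sE => /FS[].
- by move=> t; rewrite !sE => /FS[].
rewrite -!size_filter => odd_eq.
set l1 := [seq _ <- s | _] in odd_eq; set l2 := [seq _ <- s | _] in odd_eq.
have -> : size [seq t <- box2 n | t.1 * t.1 + c * (t.2 * t.2) == n] = size l2.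
  apply: (@size_bij _ _ _ _ (fun t => (t.1, t.2, t.2)) fst).
  - by rewrite filter_uniq ?uniq_box2.
  - by rewrite filter_uniq.
  - by move=> [x y]; rewrite !mem_filter sE => /andP[e _]; rewrite eqxx /= e.
  - move=> [[x y] z]; rewrite !mem_filter sE => /andP[/eqP[zy _] St].
    rewrite zy in St *; split=> //; rewrite mem_box2.
    by move: (Sbox _ St); rewrite mem_box3 /= => /and3P[-> -> _]; rewrite !andbT.
have -> : size [seq d <- iota 1 n | (d %| n) && (d * d < n)] = size l1.
  apply: (@size_bij _ _ _ _ (fun d => (d, d, (n %/ d - d) %/ c)) (fun t => t.1.1)).
  - by rewrite filter_uniq ?iota_uniq.
  - by rewrite filter_uniq.
  - move=> d; rewrite !mem_filter sE mem_iota => /andP[/andP[dn ddn] /andP[d0 _]].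
    have ne := divnK dn; set e := n %/ d in ne *.
    have de : d < e by nia.
    have /divnK cK : c %| e - d by apply: cdvd => //; rewrite mulnC.
    have St : S (d, d, (e - d) %/ c) by apply/eqP; nia.
    by rewrite Ffix// eqxx St.
  - move=> [[x y] z]; rewrite !mem_filter sE => /andP[Fx St].
    have [x0 y0 z0] := S0 _ _ _ St; move: Fx; rewrite Ffix// => /eqP yx; subst y.
    have e : n = (x + c * z) * x by move/eqP: St; nia.
    rewrite /= mem_iota e dvdn_mull// mulnK// addnC addnK mulKn//; split=> //.
    by apply/andP; split; nia.
apply/esym/odd_eq => t; rewrite ?sE; first exact: swS.
by case: t => [[]].
Qed.

(** Only the middle branch of [zagier] has fixed points, and there 2 y - x = x. If d e = 1 mod 4
    then d = e mod 4, so every factorization of n gives a fixed point. *)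
Lemma two_squares_parity n : n %% 4 = 1 -> (forall m, m * m <> n) ->
  odd (count (fun t => t.1 * t.1 + 4 * (t.2 * t.2) == n) (box2 n)) =
  odd (count (fun d => (d %| n) && (d * d < n)) (iota 1 n)).
Proof.
move=> n4 nsq; apply: (windmill_parity (F := zagier)) => //.
- by move=> x y z /(zagierP n4 nsq)[].
- by move=> t /(zagierK n4 nsq).
- move=> x y z St; have [x0 y0 z0 b1 b2] := zagierP n4 nsq St.
  rewrite /zagier; apply/eqP/eqP; last first.
    by move=> ?; subst; rewrite ifF ?ifT; try lia; congr (_, _, _); lia.
  by case: ifP => h1; [|case: ifP => h2]; case; lia.
- move=> d e de lt_de.
  have : d %% 4 * (e %% 4) %% 4 = 1 by rewrite modnMm de.
  have : d %% 4 < 4 by rewrite ltn_mod.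
  have : e %% 4 < 4 by rewrite ltn_mod.
  rewrite -(eqn_mod_dvd _ (ltnW lt_de)).
  by case: (e %% 4) => [|[|[|[|]]]] // _; case: (d %% 4) => [|[|[|[|]]]].
Qed.

(** Fixed points in the second branch of [jackson] are those with x = y. One in the third would have
    y = x + z, so n = (x + z)^2 + z^2, impossible mod 4; one in the fourth would have y = 2 x + z,
    so n + x^2 = 2 (x + z)^2, impossible mod 8. *)
Lemma square_plus_twice_square_parity n : n %% 8 = 3 ->
  odd (count (fun t => t.1 * t.1 + 2 * (t.2 * t.2) == n) (box2 n)) =
  odd (count (fun d => (d %| n) && (d * d < n)) (iota 1 n)).
Proof.
move=> n8; apply: (windmill_parity (F := jackson)) => //.
- by move=> x y z /(jacksonP n8)[].
- by move=> t /(jacksonK n8).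
- move=> x y z St; have [x0 y0 z0 [b1 b2 b3 b4]] := jacksonP n8 St.
  rewrite /jackson; apply/eqP/eqP; last first.
    by move=> ?; subst; rewrite ifF ?ifT; try lia; congr (_, _, _); lia.
  case: ifP => h1; [|case: ifP => h2;[|case: ifP => h3; [|case: ifP => h4]]]; case; try lia.
  + move=> e1 e2 e3; have yE : y = x + z by lia.
    have := sqr_mod4 (x + z); have := sqr_mod4 z; have : (x + z) * (x + z) + z * z = n.
      by move/eqP: St; rewrite yE; nia.
    lia.
  + move=> e1 e2 e3; have yE : y = x.*2 + z by lia.
    have := sqr_mod8 (x + z); have := sqr_mod8 x.
    have : 2 * ((x + z) * (x + z)) = n + x * x.
      by move/eqP: St; rewrite yE; nia.
    by rewrite !inE => ? /or3P[/eqP|/eqP|/eqP] ? /or3P[/eqP|/eqP|/eqP] ?; lia.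
- move=> d e de lt_de; have : odd (d * e) by lia.
  by rewrite oddM => /andP[? ?]; rewrite dvdn2; lia.
Qed.

(** * From the ternary form to a binary one *)

Definition absdiff (a b : nat) := (a - b) + (b - a).

(* (k, j) |-> (|k - 2 j|, k + 2 j), whose squares add up to 2 (k^2 + 4 j^2), *)
(* in the order that puts the component divisible by 3 second.                *)
Definition two_squares (t : nat * nat) : nat * nat :=
  let p := t.1 + t.2.*2 in let q := absdiff t.1 t.2.*2 in
  if p %% 3 == 0 then (q, p) else (p, q).

(** Half the sum and half the difference recover k and 2 j in some order; k is the odd one. *)
Definition two_squares_inv (t : nat * nat) : nat * nat :=
  let h := (t.1 + t.2)./2 in let d := (absdiff t.1 t.2)./2 in
  if odd h then (h, d./2) else (d, h./2).

(** As 3 divides neither k nor j, it divides exactly one of k + 2 j and k - 2 j, which fixes the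
    order of the components. *)
Lemma two_squaresP k j : odd k -> k %% 3 != 0 -> j %% 3 != 0 ->
  let t := two_squares (k, j) in
  [/\ odd t.1, odd t.2, t.1 %% 3 != 0, t.2 %% 3 = 0 & two_squares_inv t = (k, j)] /\
  t.1 * t.1 + t.2 * t.2 = 2 * (k * k) + 8 * (j * j).
Proof.
move=> ko k3 j3; rewrite /two_squares /two_squares_inv /absdiff /=.
case: ifPn => p3 /=; (split; last by nia); (split; try lia).
  by case: ifPn => oh; congr (_, _); lia.
by case: ifPn => oh; congr (_, _); lia.
Qed.

Lemma two_squares_invP u v : odd u -> odd v -> u %% 3 != 0 -> v %% 3 = 0 ->
  let t := two_squares_inv (u, v) in
  [/\ odd t.1, t.1 %% 3 != 0, t.2 %% 3 != 0 & two_squares t = (u, v)].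
Proof.
move=> uo vo u3 v3; rewrite /two_squares /two_squares_inv /absdiff /=.
case: ifPn => oh /=; (split; try lia).
  by case: ifPn => p3; congr (_, _); lia.
by case: ifPn => p3; congr (_, _); lia.
Qed.

(* In n = m^2 + u^2 + v^2, with (u, v) := two_squares (k, j), exchange m and u. *)
(* The fixed points are the representations n = v^2 + 2 m^2.                   *)
Lemma ternary_parity n : n %% 8 = 3 -> n %% 3 = 2 ->
  odd (count (fun t => [&& odd t.1.1, t.1.1 %% 3 != 0, odd t.1.2, t.1.2 %% 3 != 0,
     t.2 %% 3 != 0 &
     t.1.1 * t.1.1 + 2 * (t.1.2 * t.1.2) + 8 * (t.2 * t.2) == n]) (box3 n)) =
  odd (count (fun t => t.1 * t.1 + 2 * (t.2 * t.2) == n) (box2 n)).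
Proof.
move=> n8 n3; set S := (X in count X (box3 _)).
have Sbox t : S t -> t \in box3 n.
  case: t => [[m k] j] /and5P[/= mo _ ko _ /andP[_ /eqP e]].
  by rewrite mem_box3; apply/and3P; split; nia.
pose s := [seq t <- box3 n | S t].
have us : uniq s by rewrite filter_uniq ?uniq_box3.
have sE t : (t \in s) = S t.
  by rewrite mem_filter; case: (boolP (S t)) => // /Sbox.
rewrite -size_filter -/s; clearbody s.
pose F (t : nat * nat * nat) : nat * nat * nat :=
  let uv := two_squares (t.1.2, t.2) in
  let kj := two_squares_inv (t.1.1, uv.2) in (uv.1, kj.1, kj.2).
have FS t : S t -> S (F t) /\ F (F t) = t.
  case: t => [[m k] j] /and5P[/= mo m3 ko k3 /andP[j3 /eqP e]].
  have [[]] := two_squaresP ko k3 j3.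
  rewrite /F /=; case: (two_squares _) => u v /= uo vo u3 v3 kjE e1.
  have := two_squares_invP mo vo m3 v3; case: (two_squares_inv _) => k' j' /= [ko' k3' j3' uvE].
  rewrite uvE /= kjE; split=> //; rewrite /S /= uo u3 ko' k3' j3' /=.
  have [_] := two_squaresP ko' k3' j3'; rewrite uvE /=; lia.
rewrite (@odd_size_involution _ s F us); first last.
- by move=> t; rewrite sE => /FS[].
- by move=> t; rewrite !sE => /FS[].
congr odd; rewrite -!size_filter.
apply: (@size_bij _ _ _ _ (fun t => ((two_squares (t.1.2, t.2)).2, t.1.1))
  (fun t => (t.2, (two_squares_inv (t.2, t.1)).1, (two_squares_inv (t.2, t.1)).2))).
- by rewrite filter_uniq.
- by rewrite filter_uniq ?uniq_box2.
- move=> [[m k] j]; rewrite !mem_filter sE => /andP[/eqP +].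
  move=> + /and5P[/= mo m3 ko k3 /andP[j3 /eqP e]].
  have [[]] := two_squaresP ko k3 j3; rewrite /F /=; case: (two_squares _) => u v /= uo vo u3 v3 kjE e1.
  case=> um _ _; rewrite -um kjE; split=> //; rewrite mem_box2.
  have leq_sq i : i <= i * i by case: i => // i; rewrite leq_pmull.
  have := leq_sq u; have := leq_sq v; rewrite -um in e.
  by move=> *; apply/and3P; split; [apply/eqP|idtac|idtac]; lia.
- move=> [v m]; rewrite !mem_filter sE => /andP[/eqP /= e _].
  (* The binary count carries no side conditions: n = 2 mod 3 forces 3 to divide v but not m, and n
     = 3 mod 8 forces both to be odd. *)
  have v3 : v %% 3 = 0 by have := sqr_mod3 v; have := sqr_mod3 m; lia.
  have m3 : m %% 3 != 0 by have := sqr_mod3 v; have := sqr_mod3 m; lia.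
  have vo : odd v by rewrite -[odd v]andbb -oddM; lia.
  have mo : odd m.
    rewrite -[odd m]andbb -oddM.
    have := sqr_mod8 v; have := sqr_mod8 m; rewrite !inE.
    by move=> /or3P[/eqP|/eqP|/eqP] ? /or3P[/eqP|/eqP|/eqP] ?; lia.
  have := two_squares_invP mo vo m3 v3; rewrite /F /S.
  case E: (two_squares_inv _) => [k' j'] /= [ko' k3' j3' uvE].
  rewrite uvE /= E eqxx; split=> //.
  rewrite mo m3 ko' k3' j3' /=.
  have [_] := two_squaresP ko' k3' j3'; rewrite uvE /=; lia.
Qed.

(** * The number of divisors *)

Lemma size_divisors_prime_power p a : prime p -> size (divisors (p ^ a)) = a.+1.
Proof.
move=> pp; have pa0 : 0 < p ^ a by rewrite expn_gt0 prime_gt0.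
rewrite -(size_iota 0 a.+1).
apply: (@size_bij _ _ _ _ (logn p) (expn p)); rewrite ?divisors_uniq ?iota_uniq//.
- move=> x; rewrite -dvdn_divisors// => /(dvdn_pfactor _ _ pp)[i ia ->].
  by rewrite pfactorK// mem_iota.
- by move=> i; rewrite mem_iota -dvdn_divisors// => ia; rewrite dvdn_exp2l ?pfactorK.
Qed.

(** By coprimality a divisor d of m n is the product of gcd(d, m) and gcd(d, n). *)
Lemma size_divisorsM m n : 0 < m -> 0 < n -> coprime m n ->
  size (divisors (m * n)) = size (divisors m) * size (divisors n).
Proof.
move=> m0 n0 mn; have mn0 : 0 < m * n by rewrite muln_gt0 m0.
rewrite -(size_allpairs pair).
apply: (@size_bij _ _ _ _ (fun d => (gcdn d m, gcdn d n)) (fun t => t.1 * t.2)).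
- exact: divisors_uniq.
- by apply: allpairs_uniq; rewrite ?divisors_uniq// => -[? ?] [? ?].
- move=> d; rewrite -dvdn_divisors// => dmn; split.
    by apply/allpairsP; exists (gcdn d m, gcdn d n); rewrite -!dvdn_divisors// !dvdn_gcdr.
  apply/eqP; rewrite eqn_dvd Gauss_dvd; last first.
    by apply: coprime_dvdl (dvdn_gcdr d m) _; apply: coprime_dvdr (dvdn_gcdr d n) _.
  rewrite !dvdn_gcdl /= muln_gcdr !muln_gcdl !dvdn_gcd dmn.
  by rewrite (dvdn_mull m (dvdnn d)) !(dvdn_mulr _ (dvdnn d)).
- move=> _ /allpairsP[[x y] [/= + + ->]]; rewrite -!dvdn_divisors// => xm yn; split.
    by rewrite dvdn_mul.
  have cmy : coprime m y by apply: coprime_dvdr yn _.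
  have cnx : coprime n x by rewrite coprime_sym; apply: coprime_dvdl xm _.
  rewrite gcdnC Gauss_gcdl// [gcdn (x * y) n]gcdnC Gauss_gcdr//.
  by rewrite (gcdn_idPr xm) (gcdn_idPr yn).
Qed.

Lemma square_of_even_logn n : 0 < n -> (forall p, ~~ odd (logn p n)) ->
  exists k, n = k * k.
Proof.
move=> n0 ev; rewrite [n]prod_prime_decomp// prime_decompE big_map.
apply: (big_ind (fun x => exists k, x = k * k)); [by exists 1| |].
  by move=> _ _ [i ->] [j ->]; exists (i * j); lia.
move=> p _ /=; exists (p ^ (logn p n)./2).
by rewrite -expnD addnn even_halfK.
Qed.

Lemma exists_odd_logn n : 0 < n -> (forall k, k * k <> n) ->
  exists2 p, prime p & odd (logn p n).
Proof.
move=> n0 nsq; case: (boolP (has (fun p => odd (logn p n)) (primes n))).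
  by case/hasP => p; rewrite mem_primes => /and3P[pp _ _] o; exists p.
move=> /hasPn H; have [|k nk] := square_of_even_logn n0; last by case: (nsq k).
move=> p; case: (boolP (p \in primes n)) => [/H//|].
by rewrite -logn_gt0 lt0n negbK => /eqP->.
Qed.

(** Some prime has odd exponent a in n. If the cofactor is not a square, a second prime has odd
    exponent b, and (a + 1)(b + 1), a multiple of 4, divides the number of divisors. *)
Lemma prime_times_square_of_divisors n : 0 < n -> (forall k, k * k <> n) ->
  ~~ (4 %| size (divisors n)) -> exists p k, prime p /\ n = p * (k * k).
Proof.
move=> n0 nsq n4; have [p pp po] := exists_odd_logn n0 nsq.
have [m pm nE] := pfactor_coprime pp n0; set a := logn p n in po nE.
have m0 : 0 < m by case: m nE {pm} => // nE; rewrite nE in n0.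
have tauE : size (divisors n) = size (divisors m) * a.+1.
  rewrite nE size_divisorsM ?size_divisors_prime_power// ?expn_gt0 ?prime_gt0//.
  by rewrite coprimeXr// coprime_sym.
have [[k km]|msq] := EM (exists k, k * k = m).
  exists p, (k * p ^ a./2); split=> //; rewrite nE -km.
  have aE : a = (a./2 + a./2).+1 by lia.
  by rewrite {1}aE expnS expnD; nia.
have [k km|q qp qo] := exists_odd_logn m0; first by apply: msq; exists k.
have [m' qm mE] := pfactor_coprime qp m0; set b := logn q m in qo mE.
have m'0 : 0 < m' by case: m' mE {qm} => // mE; rewrite mE in m0.
have tauE' : size (divisors m) = size (divisors m') * b.+1.
  rewrite mE size_divisorsM ?size_divisors_prime_power// ?expn_gt0 ?prime_gt0//.
  by rewrite coprimeXr// coprime_sym.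
case/negP: n4; rewrite tauE tauE' -mulnA dvdn_mull//.
by apply: (@dvdn_mul 2 2); rewrite dvdn2 /= negbK.
Qed.

(** The map d |-> n / d exchanges the divisors below and above the square root of n. *)
Lemma size_divisors_nonsquare n : 0 < n -> (forall k, k * k <> n) ->
  size (divisors n) = (count (fun d => (d %| n) && (d * d < n)) (iota 1 n)).*2.
Proof.
move=> n0 nsq.
have -> : size (divisors n) = count (dvdn^~ n) (iota 1 n).
  rewrite -size_filter; apply: (@size_bij _ _ _ _ id id);
    rewrite ?divisors_uniq ?filter_uniq ?iota_uniq//.
    move=> d; rewrite mem_filter mem_iota -dvdn_divisors// => dn.
    by rewrite dn (dvdn_gt0 n0 dn) add1n ltnS dvdn_leq.
  by move=> d; rewrite mem_filter -dvdn_divisors// => /andP[].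
set l := [seq d <- iota 1 n | d %| n].
have ul : uniq l by rewrite filter_uniq ?iota_uniq.
have lE d : (d \in l) = (d %| n).
  rewrite mem_filter mem_iota andb_idr// => dn.
  by rewrite (dvdn_gt0 n0 dn) add1n ltnS dvdn_leq.
have -> : count (dvdn^~ n) (iota 1 n) = size l by rewrite size_filter.
have -> : count (fun d => (d %| n) && (d * d < n)) (iota 1 n) = count (fun d => d * d < n) l.
  by rewrite count_filter; apply: eq_count => d; rewrite /= andbC.
rewrite -(count_predC (fun d => d * d < n)) -addnn; congr addn.
clearbody l.
rewrite -!size_filter; apply: (@size_bij _ _ _ _ (divn n) (divn n)); rewrite ?filter_uniq//.
  move=> d; rewrite !mem_filter !lE /= -leqNgt => /andP[ddn dn].
  have e := divnK dn; have nddn := @nsq d; set c := n %/ d in e *.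
  have c0 : 0 < c by nia.
  rewrite -e mulKn// dvdn_mulr//; split=> //; nia.
move=> d; rewrite !mem_filter !lE /= -leqNgt => /andP[ddn dn].
have e := divnK dn; have nddn := @nsq d; set c := n %/ d in e *.
have c0 : 0 < c by nia.
rewrite -e mulKn// dvdn_mulr//; split=> //; nia.
Qed.

Lemma prime_times_square_of_odd n : 0 < n -> (forall k, k * k <> n) ->
  odd (count (fun d => (d %| n) && (d * d < n)) (iota 1 n)) ->
  exists p k, prime p /\ n = p * (k * k).
Proof.
move=> n0 nsq o; apply: prime_times_square_of_divisors => //.
by rewrite size_divisors_nonsquare//; lia.
Qed.

(** * Counting numbers of the form p k^2 *)

Lemma prod_primes_dvdn (s : seq nat) m : uniq s -> all prime s ->
  all (dvdn^~ m) s -> \prod_(p <- s) p %| m.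
Proof.
elim: s => [|p s IH] /=; first by rewrite big_nil dvd1n.
move=> /andP[ps us] /andP[pp sp] /andP[pm sm].
rewrite big_cons Gauss_dvd ?pm ?IH//.
rewrite big_seq; apply: (big_ind (coprime p)); [exact: coprimen1| |].
  by move=> x y; rewrite coprimeMr => -> ->.
move=> q qs; rewrite prime_coprime// dvdn_prime2// ?(allP sp)//.
by apply: contraNneq ps => ->.
Qed.

Lemma sum_floor_sqr_le n : \sum_(1 <= k < n.+1) n %/ (k * k) <= n.*2.
Proof.
case: n => [|n]; first by rewrite big_geq.
set N := n.+1; rewrite big_ltn// muln1 divn1 -addnn leq_add2l.
(* Telescoping: 1/k^2 <= 1/(k - 1) - 1/k, in a version with floors. *)
suff H m : \sum_(2 <= k < m.+2) N %/ (k * k) + N %/ m.+1 <= N.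
  by apply: leq_trans (H n); rewrite leq_addr.
elim: m => [|m IH]; first by rewrite big_geq// divn1.
apply: leq_trans IH; rewrite big_nat_recr//= -addnA leq_add2l leq_divRL//.
have h1 := leq_divM N (m.+2 * m.+2); have h2 := leq_divM N m.+2.
set a := N %/ (_ * _) in h1 *; set b := N %/ _ in h2 *.
rewrite -(@leq_pmul2r (m.+2 * m.+2))//; nia.
Qed.

(** The two equal middle coefficients are among those summing to 2^(2m+1). *)
Lemma bin_middle_le m : 'C(m.*2.+1, m) <= 4 ^ m.
Proof.
have h : \sum_(i < m.*2.+2) 'C(m.*2.+1, i) = 2 ^ m.*2.+1.
  by rewrite -[2]/(1 + 1) Pascal; apply: eq_bigr => i _; rewrite !exp1n !muln1.
have e : 'C(m.*2.+1, m.+1) = 'C(m.*2.+1, m) by rewrite -bin_sub; [congr binomial; lia|lia].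
have mlt : m < m.*2.+2 by lia.
have m1lt : m.+1 < m.*2.+2 by lia.
move: h; rewrite (bigD1 (Ordinal mlt))//= (bigD1 (Ordinal m1lt))/= ?e; last first.
  by rewrite -val_eqE /=; lia.
have -> : 4 ^ m = 2 ^ m.*2 by rewrite -mul2n expnM.
by rewrite expnS; set x := 'C(_, _); lia.
Qed.

(** The argument of Erdős: an even n > 2 is not prime, and for n = 2m+1 the primes in (m+1, 2m+1]
    all divide the binomial coefficient bounded in [bin_middle_le]. *)
Lemma primorial_le n : \prod_(p <- iota 0 n.+1 | prime p) p <= 4 ^ n.
Proof.
elim/ltn_ind: n => n IH.
have [n2|n2] := leqP n 2; first by case: n n2 {IH} => [|[|[|]]]// _; rewrite unlock.
have [no|ne] := boolP (odd n); last first.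
  have np : ~~ prime n.
    by apply: contra ne => /even_prime[e|->//]; rewrite e in n2.
  rewrite -[n.+1]addn1 iotaD big_cat/= add0n big_cons big_nil (negPf np) muln1.
  case: n n2 np ne IH => // n n2 np ne IH.
  by apply: leq_trans (IH n _) _; rewrite ?leq_exp2l//.
have nE : n = n./2.*2.+1 by lia.
set m := n./2 in nE; rewrite nE.
rewrite (_ : m.*2.+2 = m.+2 + m)%N; last by lia.
rewrite iotaD big_cat/= -/(iota 0 m.+2).
rewrite (_ : 4 ^ m.*2.+1 = 4 ^ m.+1 * 4 ^ m)%N; last by rewrite -expnD; congr expn; lia.
apply: leq_mul; first by apply: IH; lia.
apply: leq_trans (bin_middle_le m); rewrite dvdn_leq ?bin_gt0//; first by lia.
rewrite -big_filter; apply: prod_primes_dvdn; rewrite ?filter_uniq ?iota_uniq ?filter_all//.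
apply/allP => p; rewrite mem_filter mem_iota => /andP[pp pm].
have fm : m.*2.+1 - m = m.+1 by lia.
have pf k : k < p -> ~~ (p %| k`!).
  elim: k => [|k IHk] kp; first by rewrite dvdn1 gtn_eqF ?prime_gt1.
  by rewrite factS Euclid_dvdM// negb_or IHk ?(ltnW kp)// gtnNdvd.
have : p %| (m.*2.+1)`! by apply: dvdn_fact; lia.
rewrite -(@bin_fact m.*2.+1 m) ?fm; last by lia.
have m1p : m.+1 < p by move: pm => /andP[].
have /negPf pm1 : ~~ (p %| m.+1) by rewrite gtnNdvd.
by rewrite !Euclid_dvdM// (negPf (pf m (ltnW m1p))) pm1 => /orP[].
Qed.

(** Each pair counted contributes a factor p >= y. For fixed k the primes are at most N / k^2, so
    their product is at most 4^(N / k^2), and [sum_floor_sqr_le] bounds the total exponent. *)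
Lemma expn_count_large_prime_square (N y : nat) :
  y ^ (count (fun t => [&& prime t.1, y <= t.1 & t.1 * (t.2 * t.2) <= N])
        [seq (p, k) | k <- iota 1 N, p <- iota 0 N.+1]) <= 4 ^ N.*2.
Proof.
set L := (X in count _ X); set P := (X in count X _).
have -> : y ^ count P L = \prod_(t <- L | P t) y by rewrite big_const_seq iter_muln_1.
apply: (@leq_trans (\prod_(t <- L | P t) t.1)).
  by apply: leq_prod => t /and3P[].
rewrite big_mkcond big_allpairs_dep.
apply: (@leq_trans (\prod_(k <- iota 1 N) 4 ^ (N %/ (k * k)))).
  rewrite big_seq [leqRHS]big_seq; apply: leq_prod => k; rewrite mem_iota => /andP[k0 _].
  have kk0 : 0 < k * k by rewrite muln_gt0 k0.
  apply: leq_trans (primorial_le _).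
  have -> : N.+1 = (N %/ (k * k)).+1 + (N - N %/ (k * k)).
    by have := leq_div N (k * k); lia.
  rewrite iotaD big_cat/= [X in _ * X]big1_seq ?muln1; last first.
    move=> p; rewrite mem_iota add0n => /andP[_ /andP[pgt _]]; case: ifP => // /and3P[_ _].
    by rewrite -leq_divRL// leqNgt pgt.
  rewrite [leqRHS]big_mkcond; apply: leq_prod => p _.
  by rewrite /P /=; case: ifP => [/andP[->]//|_]; case: ifP => // /prime_gt0.
rewrite -expn_sum leq_exp2l//; have := sum_floor_sqr_le N.
by rewrite /index_iota subn1.
Qed.

(** For n > 0, k^2 <= n <= N forces k <= s, so at most y s pairs have p < y. The witness c is the
    number of pairs with p >= y. *)
Lemma count_prime_square (N y s : nat) (l : seq nat) : uniq l -> N < s.+1 * s.+1 ->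
  (forall n, n \in l -> n <= N /\ exists p k, prime p /\ n = p * (k * k)) ->
  exists2 c, size l <= (y * s + c).+1 & y ^ c <= 4 ^ N.*2.
Proof.
move=> ul Ns lP; eexists; last exact: expn_count_large_prime_square.
set L := (X in count _ X); set P := (X in count X _).
pose m (t : nat * nat) := t.1 * (t.2 * t.2).
pose small := [seq (p, k) | p <- iota 0 y, k <- iota 1 s].
(* The leading 0 accounts for n = 0, which no pair with k > 0 produces. *)
pose l' := 0 :: [seq m t | t <- small] ++ [seq m t | t <- L & P t].
have -> : (y * s + count P L).+1 = size l'.
  by rewrite /= size_cat !size_map size_allpairs !size_iota size_filter.
apply: uniq_leq_size => // n /lP[nN [p [k [pp nE]]]].
rewrite inE; have [//|n0] := eqVneq n 0.
rewrite /= mem_cat nE; apply/orP.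
have p0 := prime_gt0 pp.
have k0 : 0 < k by case: k nE {nN} => // nE; rewrite nE !muln0 in n0.
have kk : k * k <= n by rewrite nE leq_pmull.
have kk' : k <= k * k by rewrite leq_pmull.
have ks : k <= s.
  by rewrite leqNgt; apply/negP => sk; have := leq_mul sk sk; lia.
have [py|yp] := ltnP p y; [left|right]; apply/mapP; exists (p, k) => //.
  apply/allpairsP; exists (p, k); rewrite !mem_iota /=; split=> //; lia.
rewrite mem_filter; apply/andP; split; first by rewrite /P/= pp yp -nE.
apply/allpairsP; exists (k, p); rewrite !mem_iota /=; split=> //; first by lia.
have : p <= n by rewrite nE leq_pmulr// muln_gt0 k0.
lia.
Qed.

(** * Laurent series over F_2: squaring, supports, generating functions *)

Local Open Scope classical_set_scope.
Local Open Scope ring_scope.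

Lemma F2_addrr (x : 'F_2) : x + x = 0.
Proof. by apply/val_inj; case: x => [[|[|]]]. Qed.

Lemma F2_oppr (x : 'F_2) : - x = x.
Proof. by apply/eqP; rewrite eq_sym -subr_eq0 opprK F2_addrr. Qed.

Lemma F2_mulrr (x : 'F_2) : x * x = x.
Proof. by apply/val_inj; case: x => [[|[|]]]. Qed.

Lemma F2_natr (n : nat) : n%:R = (odd n)%:R :> 'F_2.
Proof. by elim: n => // n IH; rewrite -natr1 IH /=; case: (odd n); apply/val_inj. Qed.

(** The terms i and k - i cancel, and only a middle one survives. Applied to the coefficients of f *
    f, this is f(x)^2 = f(x^2). *)
Lemma F2_palindrome (G : nat -> 'F_2) k :
  (forall i, (i <= k)%N -> G i = G (k - i)%N) ->
  \sum_(i < k.+1) G i = if odd k then 0 else G k./2.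
Proof.
elim/ltn_ind: k G => -[|[|k]] IH G Gk.
- by rewrite big_ord1.
- by rewrite big_ord_recr big_ord1/= (Gk 0%N)// F2_addrr.
rewrite big_ord_recl big_ord_recr /= (Gk 0%N)// subn0.
rewrite addrCA F2_addrr addr0 negbK.
rewrite (IH k _ (fun i => G i.+1)) ?leqnSn// => i ik.
by rewrite Gk; [congr G; lia|lia].
Qed.

Definition sq (f : laurent 'F_2) := f * f.

Lemma coef_addE (f g : laurent 'F_2) n : (f + g) n = f n + g n.
Proof. by []. Qed.

Lemma coef_sqE (f : laurent 'F_2) n :
  sq f n = if (2 %| n)%Z then f (n %/ 2)%Z else 0.
Proof.
have [N fN] := lcoef_bound f.
have [nN|/int_ge_ex[k ->]] := ltP n (N + N).
  by rewrite [LHS](conv_lt fN fN)//; case: ifP => // _; rewrite fN//; lia.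
rewrite [LHS](convE k fN fN).
rewrite (@F2_palindrome (fun i => f (N + i%:Z) * f (N + (k - i)%N%:Z))); last first.
  by move=> i ik; rewrite subKn// mulrC.
have -> : (2 %| N + N + k%:Z)%Z = ~~ odd k by lia.
case: ifP => //= ok; have -> : (k - k./2 = k./2)%N by lia.
by rewrite F2_mulrr; congr (f _); lia.
Qed.

Lemma laurent_addrr (f : laurent 'F_2) : f + f = 0.
Proof. by apply: laurentP => n; rewrite coef_addE F2_addrr. Qed.

Lemma sqD (f g : laurent 'F_2) : sq (f + g) = sq f + sq g.
Proof.
have e : f * g + f * g = 0 by exact: laurent_addrr.
by rewrite /sq mulrDl !mulrDr [g * f]mulrC; ring: e.
Qed.

Lemma sqM (f g : laurent 'F_2) : sq (f * g) = sq f * sq g.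
Proof. by rewrite /sq mulrACA. Qed.

Definition supp (q r : int) (f : laurent 'F_2) :=
  forall n, f n <> 0 -> (n = r %[mod q])%Z.

Lemma suppM q r r' f g : supp q r f -> supp q r' g -> supp q (r + r') (f * g).
Proof.
move=> fr gr n fgn; apply: contrapT => nr; apply: fgn.
apply: fsbig1 => i _.
have [->|/eqP /fr fi] := eqVneq (f i) 0; first by rewrite mul0r.
have [->|/eqP /gr gi] := eqVneq (g (n - i)) 0; first by rewrite mulr0.
by case: nr; rewrite -[n](subrKC i) -[LHS]modzDm fi gi modzDm.
Qed.

Lemma supp_sq q r f : supp q r f -> supp (2 * q) (2 * r) (sq f).
Proof.
move=> fr n; rewrite coef_sqE; case: ifP => // n2 /fr/eqP.
have {2}-> : n = 2 * (n %/ 2)%Z by rewrite mulrC divzK.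
by rewrite eqz_mod_dvd => h; apply/eqP; rewrite eqz_mod_dvd -mulrBr dvdz_mul.
Qed.

(* Up to degree N, f is the sum of x^(w t) over the t in s satisfying P. *)
Definition gf N (f : laurent 'F_2) T (s : seq T) (P : pred T) (w : T -> nat) :=
  (forall k, k < 0 -> f k = 0) /\
  (forall k : nat, (k <= N)%N -> f k%:Z = \sum_(t <- s | P t) (w t == k)%:R).

Lemma gf_mul N f g T U (s : seq T) (s' : seq U) P P' w w' :
  gf N f s P w -> gf N g s' P' w' ->
  gf N (f * g) [seq (t, u) | t <- s, u <- s']
    (fun t => P t.1 && P' t.2) (fun t => (w t.1 + w' t.2)%N).
Proof.
move=> [f0 fE] [g0 gE]; split=> [k k0|k kN].
  by rewrite [LHS](conv_lt f0 g0)// addr0.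
rewrite (_ : k%:Z = 0 + 0 + k%:Z)// [LHS](convE k f0 g0).
under eq_bigr => i _.
  rewrite !add0r fE ?gE; [|by have := ltn_ord i; lia..].
  rewrite big_distrlr /=.
  over.
rewrite [RHS]big_mkcond big_allpairs_dep /=.
rewrite exchange_big [LHS]big_mkcond /=; apply: eq_bigr => t _.
case: ifP => Pt; last by rewrite big1.
rewrite exchange_big [LHS]big_mkcond /=; apply: eq_bigr => u _.
case: ifP => // P'u.
have [wk|kw] := ltnP (w t) k.+1.
  rewrite (bigD1 (Ordinal wk))//= eqxx mul1r big1 ?addr0.
    by congr (nat_of_bool _)%:R; apply/eqP/eqP; lia.
  by move=> i; rewrite -val_eqE eq_sym /= => /negPf ->; rewrite mul0r.
rewrite big1; last first.
  move=> i _; rewrite (_ : (w t == i) = false) ?mul0r//.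
  by have := ltn_ord i; lia.
by rewrite (_ : (_ == k) = false)//; lia.
Qed.

Lemma gf_sq N f T (s : seq T) P w : gf N f s P w ->
  gf N (sq f) s P (fun t => 2 * w t)%N.
Proof.
move=> [f0 fE]; split=> [k k0|k kN]; rewrite coef_sqE; case: ifP => // k2.
- by rewrite f0//; lia.
- rewrite (_ : (k%:Z %/ 2)%Z = (k./2)%:Z); last by lia.
  rewrite fE; last by lia.
  by apply: eq_bigr => t _; congr (nat_of_bool _)%:R; lia.
by rewrite big1// => t _; rewrite (_ : (_ == _) = false)//; lia.
Qed.

Lemma gf_coef N f T (s : seq T) P w (n : nat) : gf N f s P w -> (n <= N)%N ->
  f n%:Z = (odd (count (fun t => P t && (w t == n)) s))%:R.
Proof.
move=> [_ fE] nN; rewrite fE// -F2_natr -sum1_count natr_sum big_mkcondr.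
by apply: eq_bigr => t _; case: ifP.
Qed.

(** * The series a, its odd part and its inverse *)

Definition square_of (Q : pred nat) (k : nat) :=
  [exists m : 'I_k.+1, Q m && (m * m == k)%N].

Lemma square_ofP (Q : pred nat) k :
  reflect (exists2 m, Q m & (m * m)%N = k) (square_of Q k).
Proof.
apply: (iffP existsP) => [[m /andP[Qm /eqP]]|[m Qm mk]]; first by exists m.
have mlt : (m < k.+1)%N by nia.
by exists (Ordinal mlt); rewrite Qm mk /=.
Qed.

Lemma sum_square (Q : pred nat) N k : (k <= N)%N ->
  \sum_(m <- iota 0 N.+1 | Q m) (m * m == k)%N%:R = (square_of Q k)%:R :> 'F_2.
Proof.
move=> kN; case: square_ofP => [[m Qm mk]|nk]; last first.
  rewrite big1_seq// => m /andP[Qm _]; case: eqP => // mk.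
  by case: nk; exists m.
have mN : m \in [seq i <- iota 0 N.+1 | Q i] by rewrite mem_filter Qm mem_iota; nia.
rewrite -big_filter (bigD1_seq m mN) ?filter_uniq ?iota_uniq//.
rewrite mk eqxx big1; first exact: addr0.
move=> i im; case: eqP => // ik.
by case/eqP: im; nia.
Qed.

Lemma a_lt0 k : k < 0 -> a k = 0.
Proof.
move=> k0; apply: fsbig1 => n _ /=; case: eqP => // kn.
by move: k0; rewrite kn ltNge sqr_ge0.
Qed.

(** If 3 does not divide m, exactly one of m and -m is 1 mod 3, so m^2 arises once. *)
Lemma a_natE (k : nat) : a k%:Z = (square_of (fun m => m %% 3 != 0)%N k)%:R.
Proof.
case: square_ofP => [[m m3 mk]|nk]; last first.
  apply: fsbig1 => n /= n3; case: eqP => // kn; case: nk; exists `|n|%N; first by lia.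
  by move: kn; rewrite expr2; nia.
pose x : int := if (m %% 3 == 1)%N then m%:Z else - m%:Z.
rewrite /a /= /a_coef -(@fsbig_widen _ _ _ _ [set x])//=.
- rewrite fsbig_set1 (_ : k%:Z = x ^+ 2) ?eqxx//.
  by rewrite /x; case: ifP; rewrite expr2; lia.
- by move=> _ -> /=; rewrite /x; case: ifP; lia.
- move=> n [/= n3 nx]; case: eqP => // kn; case: nx.
  have : n = m%:Z \/ n = - m%:Z by rewrite expr2 in kn; nia.
  by rewrite /x; case: ifP; lia.
Qed.

Lemma gf_a N : gf N a (iota 0 N.+1) (fun m => m %% 3 != 0)%N (fun m => m * m)%N.
Proof. by split=> [|k kN]; [exact: a_lt0|rewrite a_natE sum_square]. Qed.

Definition aodd : laurent 'F_2 := a + sq (sq a).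

(** The exponents of a^4 are the 4 m^2 with m prime to 3, that is, the even squares in a; they
    cancel. *)
Lemma gf_aodd N : gf N aodd (iota 0 N.+1)
  (fun m => odd m && (m %% 3 != 0)%N) (fun m => m * m)%N.
Proof.
split=> [k k0|k kN].
  rewrite coef_addE !coef_sqE a_lt0// add0r; case: ifP => // k2; case: ifP => // k4.
  by rewrite a_lt0//; lia.
rewrite sum_square// coef_addE !coef_sqE a_natE.
have [k2|k2] := boolP (2 %| k%:Z)%Z; last first.
  rewrite addr0; congr (nat_of_bool _)%:R; apply/idP/idP => /square_ofP[m]; last first.
    by move=> /andP[_ m3] mk; apply/square_ofP; exists m.
  move=> m3 mk; apply/square_ofP; exists m => //.
  by rewrite m3 andbT -[odd m]andbb -oddM mk; lia.
have -> : square_of (fun m => odd m && (m %% 3 != 0)%N) k = false.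
  apply/negbTE/negP => /square_ofP[m /andP[mo _] mk].
  by have : odd (m * m) by [rewrite oddM mo]; rewrite mk; lia.
have [k4|k4] := boolP (2 %| k%:Z %/ 2)%Z; last first.
  rewrite addr0; case: square_ofP => // -[m m3 mk].
  have : ~~ odd (m * m) by lia.
  by rewrite oddM andbb => /even_halfK me; rewrite -me in mk; lia.
rewrite (_ : divz (divz k 2) 2 = (k %/ 4)%N%:Z); last by lia.
rewrite a_natE; apply/eqP; rewrite addr_eq0; apply/eqP.
rewrite F2_oppr; congr (nat_of_bool _)%:R; apply/idP/idP => /square_ofP[m m3 mk]; apply/square_ofP.
  have : ~~ odd (m * m) by lia.
  rewrite oddM andbb => /even_halfK me; exists m./2; first by lia.
  by rewrite -me in mk; lia.
by exists m.*2; lia.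
Qed.

Lemma supp_aodd : supp 8 1 aodd.
Proof.
move=> n n0; have [nlt|nge] := ltP n 0.
  by case: n0; case: (gf_aodd 0) => H _; exact: H.
have nE : n = `|n|%N%:Z by lia.
case: (gf_aodd `|n|) => _ /(_ _ (leqnn _)); rewrite -nE sum_square// => aE.
move: n0; rewrite aE; case: square_ofP => [[m /andP[mo _] mk] _|//].
have : (`|n| %% 8 = 1)%N; last by lia.
rewrite -mk -modnMm; have : (m %% 8 < 8)%N by rewrite ltn_mod.
have : odd (m %% 8) by lia.
by case: (m %% 8)%N => [|[|[|[|[|[|[|[|]]]]]]]].
Qed.

Lemma a_neq0 : a != 0.
Proof.
apply/eqP => /(congr1 (fun f : laurent 'F_2 => f 1%N%:Z)); rewrite a_natE.
have -> : square_of (fun m => m %% 3 != 0)%N 1 by apply/square_ofP; exists 1%N.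
by [].
Qed.

(** With b = 1/a, split a in b = a b^2 as [aodd] + a^4 and use a^4 b^2 = (a^2 b)^2 = a^2. *)
Lemma a_inv_rec : a^-1 = sq a + aodd * sq a^-1.
Proof.
have ab : a * a^-1 = 1 by rewrite mulfV ?a_neq0.
set b := a^-1 in ab *.
have aE : a = aodd + sq (sq a) by rewrite /aodd -addrA laurent_addrr addr0.
have bE : b = (aodd + sq (sq a)) * sq b by rewrite -aE /sq mulrA ab mul1r.
have sab : sq a * b = a by rewrite /sq -mulrA ab mulr1.
by rewrite {1}bE mulrDl -sqM sab addrC.
Qed.

Lemma sqDM (f g h : laurent 'F_2) : sq (f + g * h) = sq f + sq g * sq h.
Proof. by rewrite sqD sqM. Qed.

Lemma a_inv_expansion : a^-1 =
  sq a + aodd * sq (sq a) + aodd * sq aodd * sq (sq (sq a)) +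
  aodd * sq aodd * sq (sq aodd) * sq (sq (sq a^-1)).
Proof.
have e1 := a_inv_rec.
have e2 := etrans (congr1 sq e1) (sqDM _ _ _).
have e4 := etrans (congr1 sq e2) (sqDM _ _ _).
move: e1 e2 e4; set b8 := sq (sq (sq a^-1)); set b4 := sq (sq a^-1); set b2 := sq a^-1.
by move=> -> -> ->; ring.
Qed.

Lemma supp_full (f : laurent 'F_2) : supp 1 0 f.
Proof. by move=> n _; rewrite !modz1. Qed.

Lemma supp_coef0 q r f n : supp q r f -> (n <> r %[mod q])%Z -> f n = 0.
Proof. by move=> fr nr; apply: contrapT => /fr. Qed.

Lemma a_inv_coef n : a^-1 n =
  sq a n + (aodd * sq (sq a)) n + (aodd * sq aodd * sq (sq (sq a))) n +
  (aodd * sq aodd * sq (sq aodd) * sq (sq (sq a^-1))) n.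
Proof. by rewrite {1}a_inv_expansion. Qed.

Lemma supp_weaken p q r f : (p %| q)%Z -> supp q r f -> supp p r f.
Proof.
move=> pq fr n /fr/eqP; rewrite eqz_mod_dvd => h; apply/eqP.
by rewrite eqz_mod_dvd; apply: dvdz_trans h.
Qed.

Lemma supp_terms :
  [/\ supp 2 0 (sq a), supp 4 1 (aodd * sq (sq a)),
     supp 8 3 (aodd * sq aodd * sq (sq (sq a))) &
     supp 8 7 (aodd * sq aodd * sq (sq aodd) * sq (sq (sq a^-1)))].
Proof.
have s8 f : supp 8 0 (sq (sq (sq f))).
  by apply: (@supp_sq 4 0); apply: (@supp_sq 2 0); apply: (@supp_sq 1 0); exact: supp_full.
have o2 : supp 8 2 (sq aodd).
  by apply: (@supp_weaken _ 16) => //; apply: (@supp_sq 8 1); exact: supp_aodd.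
have o4 : supp 8 4 (sq (sq aodd)).
  by apply: (@supp_weaken _ 16) => //; apply: (@supp_sq 8 2).
split.
- by apply: (@supp_sq 1 0); exact: supp_full.
- apply: (@suppM _ 1 0); first exact: (@supp_weaken _ 8) supp_aodd.
  by apply: (@supp_sq 2 0); apply: (@supp_sq 1 0); exact: supp_full.
- by apply: (@suppM _ 3 0) => //; apply: (@suppM _ 1 2) => //; exact: supp_aodd.
- apply: (@suppM _ 7 0) => //; apply: (@suppM _ 3 4) => //.
  by apply: (@suppM _ 1 2) => //; exact: supp_aodd.
Qed.

(** * Elements of B(a) in U^* *)

Lemma B_prime_times_square n : B a n -> Ustar n ->
  exists p k : nat, prime p /\ n = (p * (k * k))%N%:Z.
Proof.
rewrite /B /= => Bn [n0 nU]; have [s0 s1 s3 s7] := supp_terms.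
have {n0} nE : n = `|n|%N%:Z by lia.
suff H : exists p k : nat, prime p /\ `|n|%N = (p * (k * k))%N.
  by have [p [k [pp e]]] := H; exists p, k; rewrite nE e.
move: (`|n|%N) nE Bn nU => {n} m ->; rewrite a_inv_coef.
move=> bm; case=> [n0|n1|n3]; move: bm.
- rewrite (supp_coef0 s1) ?(supp_coef0 s3) ?(supp_coef0 s7) ?addr0; [|lia..].
  rewrite coef_sqE ifT; last by lia.
  rewrite (_ : divz m 2 = (m./2)%N%:Z); last by lia.
  rewrite a_natE; case: square_ofP => // -[k _ km] _.
  by exists 2%N, k; split=> //; lia.
- rewrite (supp_coef0 s0) ?(supp_coef0 s3) ?(supp_coef0 s7) ?addr0 ?add0r; [|lia..].
  rewrite (gf_coef (gf_mul (gf_aodd m) (gf_sq (gf_sq (gf_a m)))) (leqnn m)).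
  set P := (X in count X _); set L := (X in count _ X).
  case: (boolP (odd _)) => // oP _.
  (* An odd count is positive, so some x^2 + 4 y^2 = m with x, y prime to 3, whence m = 1 + 1 mod 3.
     In particular m is not a square. *)
  have m3 : (m %% 3 = 2)%N.
    have : has P L by rewrite has_count; case: count oP.
    case/hasP => -[x y] _ /andP[/andP[/andP[/= _ x3] y3] /eqP <-].
    by have := sqr_mod3 x; have := sqr_mod3 y; lia.
  have nsq k : (k * k)%N <> m by have := sqr_mod3 k; lia.
  apply: prime_times_square_of_odd => //; first by lia.
  rewrite -two_squares_parity//; last by lia.
  (* Conversely, m = 1 mod 4 and m = 2 mod 3 force x odd and x, y prime to 3 in every
     representation. *)
  rewrite -(@eq_count _ P)// => -[x y]; rewrite /P /=; apply/idP/idP.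
    by move=> /andP[_ /eqP <-]; apply/eqP; lia.
  move=> /eqP e; have -> /= : odd x by rewrite -[odd x]andbb -oddM; lia.
  have := sqr_mod3 x; have := sqr_mod3 y => y1 x1.
  by rewrite -!andbA; apply/and3P; split; lia.
- rewrite (supp_coef0 s0) ?(supp_coef0 s1) ?(supp_coef0 s7) ?addr0 ?add0r; [|lia..].
  have gfm := gf_mul (gf_mul (gf_aodd m) (gf_sq (gf_aodd m)))
    (gf_sq (gf_sq (gf_sq (gf_a m)))).
  rewrite (gf_coef gfm (leqnn m)) {gfm}.
  set P := (X in count X _); set L := (X in count _ X).
  case: (boolP (odd _)) => // oP _.
  have m3 : (m %% 3 = 2)%N.
    have : has P L by rewrite has_count; case: count oP.
    case/hasP => -[[x y] z] _ /andP[/andP[/andP[/andP[/= _ x3] /andP[_ y3]] z3] /eqP <-].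
    by have := sqr_mod3 x; have := sqr_mod3 y; have := sqr_mod3 z; lia.
  have m8 : (m %% 8 = 3)%N by lia.
  have nsq k : (k * k)%N <> m by have := sqr_mod3 k; lia.
  apply: prime_times_square_of_odd => //; first by lia.
  rewrite -square_plus_twice_square_parity// -ternary_parity//.
  rewrite -(@eq_count _ P)// => -[[x y] z]; rewrite /P /= -!andbA.
  by do 5 congr (_ && _); lia.
Qed.

(** * The bound O(X / log X) *)

Lemma BU_count_le (R : realType) (X : R) (y s : nat) : 0 <= X ->
  (Num.truncn X < s.+1 * s.+1)%N ->
  exists2 c : nat, (BU_count X <= (y * s + c).+1)%N &
    (y ^ c <= 4 ^ (Num.truncn X).*2)%N.
Proof.
move=> X0 Xs; pose l := [seq `|n|%N | n <- fset_set (BU_upto X)].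
have inBU n : n \in fset_set (BU_upto X) -> BU_upto X n.
  by rewrite in_fset_set ?inE//; exact: BU_upto_finite.
have -> : BU_count X = size l by rewrite size_map.
apply: count_prime_square => //.
  rewrite map_inj_in_uniq ?fset_uniq// => m n /inBU[_ [m0 _] _] /inBU[_ [n0 _] _]; lia.
move=> _ /mapP[n /inBU[Bn Un nX] ->]; have [n0 _] := Un; split.
  by rewrite truncn_ge_nat// natr_absz ger0_norm.
by have [p [k [pp ->]]] := B_prime_times_square Bn Un; exists p, k.
Qed.

(** Take u = X^(1/4), y just above u and s the integer part of u^2. Then 33 = 8 + 24 + 1: y s ln X
    <= 2 u * u^2 * 4 u = 8 X; c ln u <= 2 X ln 4 <= 6 X with ln X = 4 ln u gives c ln X <= 24 X; and
    ln X <= X absorbs the extra 1. *)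
Lemma BU_count_le_ln (R : realType) (X : R) : 1 < X ->
  (BU_count X)%:R <= 33 * (X / ln X).
Proof.
move=> X1; have X0 : 0 < X by apply: lt_trans X1.
have lnX : 0 < ln X by rewrite ln_gt0.
pose u := Num.sqrt (Num.sqrt X).
have u2 : u ^+ 2 = Num.sqrt X by rewrite sqr_sqrtr// sqrtr_ge0.
have u4 : u ^+ 4 = X by rewrite (exprM _ 2 2) u2 sqr_sqrtr// ltW.
have u1 : 1 < u.
  rewrite ltNge; apply/negP => ule; move: X1; rewrite -u4 ltNge.
  by rewrite exprn_ile1// sqrtr_ge0.
have u0 : 0 < u by apply: lt_trans u1.
have lnu : ln X = 4 * ln u by rewrite -u4 lnXn// mulr_natl.
pose y := (Num.truncn u).+1; pose s := Num.truncn (u ^+ 2).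
have uy : u < y%:R by rewrite truncnS_gt.
have yu : y%:R <= 2 * u.
  have : (Num.truncn u)%:R <= u by rewrite truncn_le ltW.
  by rewrite /y -natr1; lra.
have su : s%:R <= u ^+ 2 by rewrite truncn_le exprn_ge0 // ltW.
have [||c cle ycle] := @BU_count_le R X y s; first exact: ltW.
  rewrite -(ltr_nat R); apply: (@le_lt_trans _ _ X); first by rewrite truncn_le ltW.
  have : u ^+ 2 < s.+1%:R by rewrite truncnS_gt.
  by rewrite -u4 natrM => h; rewrite (exprM _ 2 2) [_ ^+ 2 ^+ 2]expr2 ltr_pM// exprn_ge0 ?ltW.
have lnuu : ln u <= u by have := @ln_sublinear R u u0; lra.
have y0 : 0 < y%:R :> R by rewrite ltr0n.
have cX : c%:R * ln X <= 24 * X.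
  have ln4 : ln (4 : R) <= 3.
    have -> : (4 : R) = 1 + 3 by ring.
    by apply: le_ln1Dx; lra.
  have lny : ln u <= ln y%:R by rewrite ler_ln ?posrE// ltW.
  have NX : (Num.truncn X)%:R <= X by rewrite truncn_le ltW.
  have : ln (y%:R ^+ c) <= ln (4 ^+ (Num.truncn X).*2 : R).
    by rewrite ler_ln ?posrE ?exprn_gt0// -natrX -(natrX _ 4) ler_nat.
  rewrite !lnXn// -[ln y%:R *+ _]mulr_natl -[ln 4 *+ _]mulr_natl -muln2 natrM lnu => h.
  have h1 : c%:R * ln u <= c%:R * ln y%:R by rewrite ler_wpM2l.
  have h2 : (Num.truncn X)%:R * 2 * ln 4 <= X * 2 * 3.
    by rewrite ler_pM ?mulr_ge0 ?ln_ge0 ?ler_pM2r//; lra.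
  lra.
have ys : y%:R * s%:R * ln X <= 8 * X.
  have -> : 8 * X = 2 * u * u ^+ 2 * (4 * u) by rewrite -u4; ring.
  by rewrite !ler_pM ?mulr_ge0 ?(ltW lnX)// lnu; lra.
have lnXX : ln X <= X by apply/ltW/ln_sublinear.
rewrite mulrA ler_pdivlMr//.
have : (BU_count X)%:R <= y%:R * s%:R + c%:R + 1 :> R.
  by rewrite -natrM -natrD natr1 ler_nat.
by rewrite -(ler_pM2r lnX) => /le_trans; apply; rewrite !mulrDl; lra.
Qed.

Theorem theorem2p9 (R : realType) :
  (forall n : int, B a n -> Ustar n -> prime_times_square n) /\
  (fun X : R => (BU_count X)%:R : R) =O_ +oo (fun X : R => X / ln X : R).
Proof.
split=> [n Bn Un|].
  have [p [k [pp ->]]] := B_prime_times_square Bn Un.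
  by exists p, k%:Z; split=> //; rewrite !PoszM.
apply/eqO_exP; exists 33 => //; near=> X.
have X1 : 1 < X by near: X; exact: nbhs_pinfty_gt.
rewrite !ger0_norm ?divr_ge0 ?ln_ge0 ?BU_count_le_ln//; lra.
Unshelve. all: by end_near.
Qed.
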